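(* Let $n$ and $k$ be positive integers and let $f = f(x_1, x_2, \ldots, x_n) \in \mathbb{Z}[x_1, x_2, \ldots, x_n]$ be a symmetric homogeneous polynomial of degree $k$ which contains a monomial $a x_1^k$ for some non-zero $a$ (i.e. the coefficient of $x_1^k$ in $f$ is non-zero). Then the Newton polyhedron $N_f \subset \mathbb{R}^n$ of $f$ is the $k\Delta^{n-1}$-simplex, that is, $$N_f = \left\{(t_0, t_1, \ldots, t_{n-1}) \in \mathbb{R}^n \;\middle|\; \sum_{i=0}^{n-1} t_i = k \text{ and } t_i \geq 0 \text{ for } i = 0, 1, \ldots, n-1\right\}.$$
   Context: For a polynomial $f = \sum a_{i_1 \ldots i_n} x_1^{i_1} \cdots x_n^{i_n} \in \mathbb{Z}[x_1,\ldots,x_n]$, let $I_f$ be the set of multi-indices $(i_1,\ldots,i_n)$ such that $a_{i_1\ldots i_n} \neq 0$. The Newton polyhedron of $f$ is the convex hull $N_f = \mathrm{Conv}(I_f) \subset \mathbb{R}^n$. For a positive integer $k$, the standard $m$-simplex of size $k$ (called the $k\Delta^m$-simplex) is $$k\Delta^m = \left\{(t_0,t_1,\ldots,t_m) \in \mathbb{R}^{m+1} \;\middle|\; \sum_{i=0}^m t_i = k \text{ and } t_i \geq 0 \text{ for } i = 0,1,\ldots,m\right\}.$$ *)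

(* Defs.v *)
From mathcomp Require Import all_boot all_order all_algebra.
From mathcomp Require Import mpoly.
From mathcomp Require Import classical_sets reals convex.

Set Implicit Arguments.
Unset Strict Implicit.
Unset Printing Implicit Defensive.

Import Order.TTheory GRing.Theory Num.Theory.
Local Open Scope classical_set_scope.
Local Open Scope ring_scope.

Definition convex_hull (R : realType) (V : lmodType R) (A : set V) : set V :=
  smallest (@convex_set R V) A.

Definition exponent_vector (R : realType) (n : nat) (m : 'X_{1..n}) : 'rV[R]_n :=
  \row_(i < n) (m i)%:R.
Arguments exponent_vector R {n} m.

Definition exponents (n : nat) (f : {mpoly int[n]}) : set 'X_{1..n} :=
  [set m | f@_m != 0].

Definition newton_polyhedron (R : realType) (n : nat) (f : {mpoly int[n]}) :
    set 'rV[R]_n :=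
  convex_hull (exponent_vector R @` exponents f).
Arguments newton_polyhedron R {n} f.

Definition std_simplex (R : realType) (k m : nat) : set 'rV[R]_m.+1 :=
  [set t | \sum_(i < m.+1) t ord0 i = k%:R /\ forall i, 0 <= t ord0 i].
Arguments std_simplex R k m : clear implicits.

(* Main.v *)
Require Import Defs.
From mathcomp Require Import all_boot all_order all_algebra.
From mathcomp Require Import mpoly.
From mathcomp Require Import classical_sets reals convex.
From mathcomp Require Import perm interval_inference.

Import GRing.Theory Num.Theory.
Local Open Scope ring_scope.

(** The monomials of [f] have nonnegative exponents summing to [k], so their
    exponent vectors lie in the simplex, which is convex; hence the Newton
    polyhedron is contained in it ([convex_std_simplex],
    [exponent_vector_homog]).

    Conversely, the simplex is spanned by its vertices [k *: e_i].  Each vertex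
    is an exponent vector of [f]: the transposition exchanging the first
    variable and the [i]-th one turns the monomial [x_1 ^ k] into [x_i ^ k], and
    symmetry makes their coefficients equal ([mcoeff_symmetric_power]).  A point
    [t] of the simplex is the combination of the vertices with weights
    [t_i / k], so any convex set containing the vertices contains [t]
    ([convex_set_sum]). *)

Section ConvexSets.
Variables (R : realType) (V : lmodType R).
Implicit Types (A : set V) (x y : V) (a b : R).

Lemma convex_setP A :
  convex_set A <-> forall x y a b, A x -> A y -> 0 <= a -> 0 <= b -> a + b = 1 ->
                     A (a *: x + b *: y).
Proof.
split=> [cA x y a b Ax Ay a0 b0 ab1|cA x y p /set_mem Ax /set_mem Ay].
  have a1 : a <= 1 by rewrite -ab1 lerDl.
  have -> : b = 1 - a by rewrite -ab1 [a + b]addrC addrK.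
  exact: set_mem (cA x y (Itv01 a0 a1) (mem_set Ax) (mem_set Ay)).
apply/mem_set; apply: cA => //.
  by rewrite subr_ge0 le1.
by rewrite addrC subrK.
Qed.

(** Allowing weights of any total, not only [1], makes the statement pass
    through an induction on [r]: the tail of a convex combination no longer has
    total [1].  When the total vanishes so does the sum, and [y0] only serves as
    a value for [y] in that case. *)
Lemma convex_set_conic_sum A (I : Type) (r : seq I) (w : I -> R) (z : I -> V) y0 :
    convex_set A -> A y0 -> (forall i, 0 <= w i) -> (forall i, A (z i)) ->
  exists2 y, A y & \sum_(i <- r) w i *: z i = (\sum_(i <- r) w i) *: y.
Proof.
move=> /convex_setP cA Ay0 w0 Az; elim: r => [|i r [y Ay IH]].
  by exists y0 => //; rewrite !big_nil scale0r.
rewrite !big_cons IH; set s := \sum_(j <- r) w j.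
have s0 : 0 <= s by apply: sumr_ge0.
have [ws0|ws_neq0] := eqVneq (w i + s) 0.
  exists y0 => //; rewrite ws0 scale0r.
  move/eqP: ws0; rewrite paddr_eq0// => /andP[/eqP-> /eqP->].
  by rewrite !scale0r addr0.
exists ((w i / (w i + s)) *: z i + (s / (w i + s)) *: y).
  apply: cA => //; rewrite ?divr_ge0 ?addr_ge0//.
  by rewrite -mulrDl divff.
by rewrite scalerDr !scalerA ![(w i + s) * _]mulrC !divfK.
Qed.

Lemma convex_set_sum A (I : Type) (r : seq I) (w : I -> R) (z : I -> V) :
    convex_set A -> (forall i, 0 <= w i) -> (forall i, A (z i)) ->
  \sum_(i <- r) w i = 1 -> A (\sum_(i <- r) w i *: z i).
Proof.
case: r => [|i r] cA w0 Az w1.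
  by move/eqP: w1; rewrite big_nil eq_sym oner_eq0.
have [y Ay ->] := convex_set_conic_sum A I (i :: r) w z (z i) cA (Az i) w0 Az.
by rewrite w1 scale1r.
Qed.

End ConvexSets.

Lemma convex_std_simplex (R : realType) (k n : nat) :
  convex_set (std_simplex R k n).
Proof.
apply/convex_setP => x y a b [sx x0] [sy y0] a0 b0 ab1; split=> [|i].
  under eq_bigr do rewrite !mxE.
  by rewrite big_split/= -!mulr_sumr sx sy -mulrDl ab1 mul1r.
by rewrite !mxE addr_ge0 ?mulr_ge0.
Qed.

Lemma exponent_vector_homog (R : realType) (n k : nat) (f : {mpoly int[n.+1]}) m :
  f \is k.-homog -> exponents f m -> std_simplex R k n (exponent_vector R m).
Proof.
move=> /dhomogP fk; rewrite /exponents/= -mcoeff_msupp => /fk mk.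
split=> [|i]; last by rewrite mxE ler0n.
under eq_bigr do rewrite mxE.
by rewrite -natr_sum -mdegE mk.
Qed.

Lemma mcoeff_symmetric_power (S : nzRingType) (n k : nat) (f : {mpoly S[n]})
    (i j : 'I_n) :
  f \is symmetric -> f@_(U_(i) *+ k)%MM = f@_(U_(j) *+ k)%MM.
Proof.
move=> /issymP /(_ (tperm i j)) fij; rewrite -[in RHS]fij mcoeff_sym.
congr (f@__); apply/mnmP => l; rewrite mnmE !mulmnE !mnm1E.
by rewrite -(inj_eq (@perm_inj _ (tperm i j)) i l) tpermL.
Qed.

Theorem theorem3p5 (R : realType) (n k : nat) (hk : (0 < k)%N)
    (f : {mpoly int[n.+1]})
    (hsym : f \is symmetric)
    (hhom : f \is k.-homog)
    (hmon : f@_(U_(ord0) *+ k)%MM != 0) :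
  newton_polyhedron R f = std_simplex R k n.
Proof.
have k_neq0 : k%:R != 0 :> R by rewrite pnatr_eq0 -lt0n.
apply/seteqP; split.
  apply: smallest_sub; first exact: convex_std_simplex.
  by move=> _ [m fm <-]; exact: exponent_vector_homog hhom fm.
move=> t [t_sum t_ge0] A [cA fA].
pose vertex i : 'rV[R]_n.+1 := exponent_vector R (U_(i) *+ k)%MM.
have A_vertex i : A (vertex i).
  apply: fA; exists (U_(i) *+ k)%MM => //.
  by rewrite /exponents/= (mcoeff_symmetric_power _ _ _ _ i ord0).
have -> : t = \sum_i (t ord0 i / k%:R) *: vertex i.
  apply/rowP => j; rewrite summxE (bigD1 j)//= big1 => [|i ij].
    by rewrite !mxE mulmnE mnm1E eqxx mul1n divfK// addr0.
  by rewrite !mxE mulmnE mnm1E (negbTE ij) mulr0.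
apply: convex_set_sum => // [i|]; first by rewrite divr_ge0.
by rewrite -mulr_suml t_sum divff.
Qed.
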